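(* Let $\varphi$ be a 3iet preserving morphism on the alphabet $\{A,B,C\}$ and let $\boldsymbol{M}\in\mathbb{N}^{3\times 3}$ be its incidence matrix. Then $$\boldsymbol{M}\boldsymbol{E}\boldsymbol{M}^T=\boldsymbol{E}\quad\text{or}\quad \boldsymbol{M}\boldsymbol{E}\boldsymbol{M}^T=-\boldsymbol{E},\qquad\text{where } \boldsymbol{E}=\begin{pmatrix}0&1&1\\-1&0&1\\-1&-1&0\end{pmatrix}.$$
   Context: 3-interval exchange transformation (3iet): let $\alpha,\beta,\gamma>0$ be real. Put either $I_A=[0,\alpha)$, $I_B=[\alpha,\alpha+\beta)$, $I_C=[\alpha+\beta,\alpha+\beta+\gamma)$, or $I_A=(0,\alpha]$, $I_B=(\alpha,\alpha+\beta]$, $I_C=(\alpha+\beta,\alpha+\beta+\gamma]$, and $I=I_A\cup I_B\cup I_C$. The 3iet with parameters $\alpha,\beta,\gamma$ is the bijection $T:I\to I$ given by $T(x)=x+\beta+\gamma$ for $x\in I_A$, $T(x)=x-\alpha+\gamma$ for $x\in I_B$, $T(x)=x-\alpha-\beta$ for $x\in I_C$. For $x_0\in I$, the word $u_T(x_0)=(u_n)_{n\in\mathbb{Z}}\in\{A,B,C\}^{\mathbb{Z}}$ coding the orbit of $x_0$ is defined by $u_n=X$ if $T^n(x_0)\in I_X$, $X\in\{A,B,C\}$. A biinfinite word $(u_n)_{n\in\mathbb{Z}}$ is aperiodic if neither $u_0u_1u_2\cdots$ nor $\cdots u_{-3}u_{-2}u_{-1}$ is eventually periodic. A 3iet word is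 an aperiodic word of the form $u_T(x_0)$ for some 3iet $T$ (with either choice of domain) and some $x_0\in I$. A morphism $\varphi$ on $\{A,B,C\}$ is a monoid homomorphism $\{A,B,C\}^*\to\{A,B,C\}^*$; it acts on biinfinite words by $\varphi(\cdots u_{-2}u_{-1}|u_0u_1\cdots)=\cdots\varphi(u_{-2})\varphi(u_{-1})|\varphi(u_0)\varphi(u_1)\cdots$, where $|$ marks the position just before index $0$. It is 3iet preserving if $\varphi(u)$ is a 3iet word for every 3iet word $u$. The incidence matrix of $\varphi$, with the letters ordered $a_1=A,a_2=B,a_3=C$, is the matrix $\boldsymbol{M}$ whose $(i,j)$ entry is the number of occurrences of $a_j$ in $\varphi(a_i)$. Here $0\in\mathbb{N}$. *)

(* Defs.v *)
(* MathComp, with the reals an abstract realType. *)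
From HB Require Import structures.
From mathcomp Require Import all_boot all_order all_algebra.
From mathcomp Require Import reals.

Set Implicit Arguments.
Unset Strict Implicit.
Unset Printing Implicit Defensive.

Import Order.TTheory GRing.Theory Num.Theory.
Local Open Scope ring_scope.

Inductive letter : Type := A | B | C.

Definition letter_of_ord (i : 'I_3) : letter := nth A [:: A; B; C] i.

Definition ord_of_letter (X : letter) : 'I_3 :=
  match X with
  | A => @Ordinal 3 0 isT
  | B => @Ordinal 3 1 isT
  | C => @Ordinal 3 2 isT
  end.

Lemma ord_of_letterK : cancel ord_of_letter letter_of_ord.
Proof. by case. Qed.

HB.instance Definition _ := Finite.copy letter (can_type ord_of_letterK).

(* The word (u_n)_{n in Z}. *)
Definition biword : Type := int -> letter.

(* A monoid endomorphism of {A,B,C}^* is given by the images of the letters;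
   the image of a letter may be the empty word. *)
Definition morphism3 : Type := letter -> seq letter.

Definition eventually_periodic (w : nat -> letter) : Prop :=
  exists N p : nat, (0 < p)%N /\ forall n : nat, (N <= n)%N -> w (n + p)%N = w n.

(* The left half ... u_{-3} u_{-2} u_{-1} is read from right to left. *)
Definition aperiodic (u : biword) : Prop :=
  ~ eventually_periodic (fun n : nat => u n%:Z) /\
  ~ eventually_periodic (fun n : nat => u (- n.+1%:Z)).

(* [BSide true x] is [BLeft x] and [BSide false x] is [BRight x], so
   [half_open true x y] is [x, y) and [half_open false x y] is (x, y]. *)
Definition half_open (R : realType) (b : bool) (x y : R) : interval R :=
  Interval (BSide b x) (BSide b y).

Definition iet_interval (R : realType) (b : bool) (alpha beta gamma : R)
    (X : letter) : interval R :=
  match X with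
  | A => half_open b 0 alpha
  | B => half_open b alpha (alpha + beta)
  | C => half_open b (alpha + beta) (alpha + beta + gamma)
  end.

Definition in_iet_domain (R : realType) (b : bool) (alpha beta gamma : R)
    (x : R) : Prop :=
  exists X : letter, x \in iet_interval b alpha beta gamma X.

(* The value outside the domain is irrelevant. *)
Definition iet (R : realType) (b : bool) (alpha beta gamma : R) (x : R) : R :=
  if x \in iet_interval b alpha beta gamma A then x + beta + gamma
  else if x \in iet_interval b alpha beta gamma B then x - alpha + gamma
  else if x \in iet_interval b alpha beta gamma C then x - alpha - beta
  else x.

(* [x n] is T^n(x0) for every integer n: since T = iet b alpha beta gamma is a
   bijection of its domain, these conditions determine x, also for n < 0. *)
Definition iet_orbit (R : realType) (b : bool) (alpha beta gamma : R)
    (x0 : R) (x : int -> R) : Prop :=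
  [/\ x 0 = x0,
      forall n : int, in_iet_domain b alpha beta gamma (x n) &
      forall n : int, x (n + 1) = iet b alpha beta gamma (x n)].

Definition iet_coding (R : realType) (b : bool) (alpha beta gamma : R)
    (x0 : R) (u : biword) : Prop :=
  exists2 x : int -> R, iet_orbit b alpha beta gamma x0 x &
    forall n : int, x n \in iet_interval b alpha beta gamma (u n).

Definition iet_word (R : realType) (u : biword) : Prop :=
  aperiodic u /\
  exists (b : bool) (alpha beta gamma x0 : R),
    [/\ 0 < alpha, 0 < beta, 0 < gamma,
        in_iet_domain b alpha beta gamma x0 &
        iet_coding b alpha beta gamma x0 u].

(* v = phi(u): the block phi(u_i) occupies the positions p i <= m < p (i + 1)
   of v.  The first two conditions determine p.  The last one says that the
   blocks cover Z, i.e. that phi(u) is infinite in both directions, which may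
   fail when phi erases letters; v is then uniquely determined. *)
Definition morphism_image (phi : morphism3) (u v : biword) : Prop :=
  exists p : int -> int,
    [/\ p 0 = 0,
        forall i : int, p (i + 1) = p i + (size (phi (u i)))%:Z,
        forall (i : int) (k : nat), (k < size (phi (u i)))%N ->
          v (p i + k%:Z) = nth A (phi (u i)) k &
        forall m : int, exists i : int, p i <= m < p (i + 1)].

Definition iet_preserving (R : realType) (phi : morphism3) : Prop :=
  forall u : biword, iet_word R u ->
    exists2 v : biword, morphism_image phi u v & iet_word R v.

Definition incidence_matrix (phi : morphism3) : 'M[nat]_3 :=
  \matrix_(i, j) count_mem (letter_of_ord j) (phi (letter_of_ord i)).

Definition E : 'M[int]_3 :=
  \matrix_(i, j)
    (nth [::] [:: [::  0;  1; 1];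
                  [:: -1;  0; 1];
                  [:: -1; -1; 0]] i)`_j.

(* Main.v *)
Require Import Defs.
From HB Require Import structures.
From mathcomp Require Import all_boot all_order all_algebra.
From mathcomp Require Import reals.
From mathcomp Require Import zify ring lra.

Set Implicit Arguments.
Unset Strict Implicit.
Unset Printing Implicit Defensive.

Import Order.TTheory GRing.Theory Num.Theory.
Local Open Scope ring_scope.

(** The idea is to forget the letter B.  For a 3iet with lengths
    [al, be, ga] put [a := al + be] and [c := be + ga].  The letter A translates
    by [c], C translates by [- a], and B by [c - a], as A followed by C would;
    moreover the first half of that move keeps a point of the interval of B
    inside an interval of length [a + c] that contains the domain.  So replacing
    A, B, C by [true], [true; false], [false] turns every coding into the coding
    of an exchange of two intervals of lengths [a] and [c]: all its factors have
    a height, (number of [true]) * c - (number of [false]) * a, smaller than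
    [a + c] in absolute value ([coding_balanced]).  Let [image_walk phi X] be the binary word obtained from
    [phi X].  The entry of M E M^T at [(X, Y)] is the determinant [cross] of the
    letter counts of [image_walk phi X] and [image_walk phi Y]
    ([cross_incidence]), so it must be shown that the determinants of the pairs
    AB, AC, BC have a common value [l], and that [l] is 1 or -1.

    The morphism is tested on words close to periodic ones.  If a balanced
    binary word contains [z^N z1 z] with [N] large, then [c / a] is nearly the
    ratio of the letter counts of [z].  Let [(i, j)] be these counts divided by
    their gcd.  With [a = i] and [c = j] heights are integers and those reached
    along [z] already spread over [i + j - 1] ([wide_prefixes]), while the strip
    has width [i + j]; so reading [z1] between two copies of [z] shifts the
    walk by at most 1, which means that [|cross z1 z|] is at most the gcd of the
    letter counts of [z] ([balanced_cross]).

    For all [n] and all positive [k] and [N] some 3iet word contains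
    [(B A^n)^N (C A^(n+1))^k C A^n (B A^n)] ([test_word]).  The resulting bound
    is uniform in [k], hence the images of [B A^n] and [C A^(n+1)] have
    determinant zero, and that of [C A^n] and [B A^n] is bounded by the gcd of
    the counts of the latter ([test_cross]).  The cases [n = 0] and [n = 1] give
    the equality of the three determinants and two bounds of [l] by gcds that
    divide [l]; together they force [l] to be 0, 1 or -1 ([cross_relations],
    [unimodular_pair]).  Finally [l = 0] would make all image words parallel; a
    walk made of parallel pieces stays in a strip only if [a] and [c] are
    commensurable, and then the orbit visits finitely many points and its
    coding is periodic ([image_walks_not_parallel]). *)

(** * Heights of binary words and balance *)
Definition up (z : seq bool) : nat := count id z.
Definition dn (z : seq bool) : nat := count negb z.

(** The height reached by a walk that climbs by [c] at each [true] and falls by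
    [a] at each [false]. *)
Definition height (R : pzRingType) (a c : R) (z : seq bool) : R :=
  (up z)%:R * c - (dn z)%:R * a.

(** The determinant of the pairs of letter counts, see [crossE].  It is written
    as a height because, for the slope of [z'], it measures how far [z] leads
    away from the line along which the powers of [z'] travel. *)
Definition cross (z z' : seq bool) : int :=
  height (up z')%:Z (dn z')%:Z z.

(** A walk of steps [c] and [- a] inside a half-open strip of width [a + c]
    satisfies this. *)
Definition balanced (R : realType) (a c : R) (z : seq bool) : Prop :=
  forall s y t : seq bool, z = s ++ y ++ t -> `|height a c y| < a + c.

Lemma size_up_dn z : size z = (up z + dn z)%N.
Proof. by rewrite /up /dn -(count_predC id z). Qed.

Lemma up_cat z z' : up (z ++ z') = (up z + up z')%N.
Proof. exact: count_cat. Qed.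

Lemma dn_cat z z' : dn (z ++ z') = (dn z + dn z')%N.
Proof. exact: count_cat. Qed.

Lemma height_nil (R : pzRingType) (a c : R) : height a c [::] = 0.
Proof. by rewrite /height /= !mul0r subr0. Qed.

Lemma height_cat (R : pzRingType) (a c : R) z z' :
  height a c (z ++ z') = height a c z + height a c z'.
Proof.
by rewrite /height up_cat dn_cat !natrD !mulrDl opprD addrACA.
Qed.

Lemma height_power (R : pzRingType) (a c : R) N z :
  height a c (flatten (nseq N z)) = (height a c z) *+ N.
Proof.
elim: N => [|N IH] /=; first by rewrite height_nil.
by rewrite height_cat IH mulrS.
Qed.

Lemma height_intr (R : pzRingType) (i j : nat) z :
  (height i%:Z j%:Z z)%:~R = height i%:R j%:R z :> R.
Proof. by rewrite /height !natz intrB !intrM -!pmulrn. Qed.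

Lemma powerSr (T : Type) N (z : seq T) :
  flatten (nseq N.+1 z) = flatten (nseq N z) ++ z.
Proof. by elim: N => [|N IH]; rewrite /= ?cats0 // -catA -IH. Qed.

Lemma crossE z z' :
  cross z z' = (up z)%:Z * (dn z')%:Z - (dn z)%:Z * (up z')%:Z.
Proof. by rewrite /cross /height !natz. Qed.

Lemma cross_catl x y z : cross (x ++ y) z = cross x z + cross y z.
Proof. exact: height_cat. Qed.

Lemma cross_catr x y z : cross z (x ++ y) = cross z x + cross z y.
Proof. rewrite !crossE up_cat dn_cat !PoszD; ring. Qed.

Lemma cross_powerl N x z : cross (flatten (nseq N x)) z = (cross x z) *+ N.
Proof. exact: height_power. Qed.

(** Since [j = - i] modulo [s := i + j], the height after [l] steps is [l * j]
    modulo [s], and [j] is invertible modulo [s]: every residue is attained.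
    The prefix whose height has the residue just below the minimum must lie
    at least [s - 1] above that minimum. *)
Lemma wide_prefixes z g i j :
  (0 < g)%N -> coprime i j -> up z = (g * i)%N -> dn z = (g * j)%N ->
  exists l l' : nat,
    height i%:Z j%:Z (take l z) + (i + j)%:Z - 1 <= height i%:Z j%:Z (take l' z).
Proof.
move=> g0 cij hu hd; set s := (i + j)%N.
set h := fun l => height i%:Z j%:Z (take l z).
have s0 : (0 < s)%N.
  by rewrite /s lt0n; apply: contraL cij => /eqP; case: (i) (j) => [|?] [|?].
have sz : (s <= size z)%N by rewrite size_up_dn hu hd -mulnDr leq_pmull.
(* After [l] steps the height is [l * j] up to a multiple of [s]. *)
have hE l : (l <= s)%N -> h l = l%:Z * j%:Z - (dn (take l z))%:Z * s%:Z.
  move=> ls; have := size_up_dn (take l z).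
  rewrite size_take_min (minn_idPl (leq_trans ls sz)) => {2}->.
  rewrite /h /height !natz /s !PoszD; ring.
have [l _ hmin] : exists2 l : 'I_s, true & forall l' : 'I_s, h l <= h l'.
  case: (Order.TotalTheory.arg_minP (fun l : 'I_s => h l)
    (i0 := Ordinal s0) (P := predT)) => // l _ hl.
  by exists l => // l'; exact: hl.
have csj : gcdz j%:Z s%:Z = 1.
  have : coprime j s by rewrite /s /coprime gcdnDr gcdnC.
  by rewrite /coprime /gcdz /= => /eqP->.
have [u [v uv]] := Bezoutz j%:Z s%:Z; rewrite csj in uv.
(* [u] is an inverse of [j] modulo [s]; [t] is the length whose height is
   congruent to [h l - 1]. *)
pose t := ((h l - 1) * u %% s%:Z)%Z.
have t0 : 0 <= t by rewrite modz_ge0 //; lia.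
have ts : t < s%:Z by rewrite ltz_pmod.
have [Q ht] : exists Q : int, (h l - 1) * u = Q * s%:Z + t.
  by exists ((h l - 1) * u %/ s%:Z)%Z; exact: divz_eq.
clearbody t.
have tN : (`|t|%N < s)%N by lia.
have [q hq] : exists q : int, h `|t|%N = h l - 1 + q * s%:Z.
  rewrite hE ?(ltnW tN) //; have -> : (`|t|%N)%:Z = t by lia.
  set e := dn _; exists (- Q * j%:Z - e%:Z - (h l - 1) * v).
  have -> : t = (h l - 1) * u - Q * s%:Z by rewrite ht addrC addKr.
  transitivity ((h l - 1) * (u * j%:Z) - Q * s%:Z * j%:Z - e%:Z * s%:Z); first ring.
  have -> : u * j%:Z = 1 - v * s%:Z by rewrite -uv addrK.
  ring.
exists l, `|t|%N; rewrite -/(h l) -/(h _).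
have := hmin (Ordinal tN); rewrite /= hq => hh.
have q1 : 1 <= q.
  case: (lerP 1 q) => // q1; have : q * s%:Z <= 0 by nia.
  lia.
nia.
Qed.

(** The repetition of [z0] only serves to force [c / a] so close to the slope of
    [z0] that, on words as short as [z0 ++ z1 ++ z0], the real heights, rescaled
    to a strip of width [i + j], differ by less than 1 from the integer heights
    for the exact slope [(i, j)], where [i] and [j] are coprime.  Then a low
    point of one copy of [z0] and a high point of the other, both provided by
    [wide_prefixes], are separated by [i + j - 1] plus the shift due to [z1],
    while the strip allows at most [i + j]. *)
Lemma balanced_cross (R : realType) (a c : R) (z0 z1 : seq bool) (N : nat) :
  0 < a -> 0 < c -> (size (z0 ++ z1 ++ z0) <= N)%N ->
  balanced a c (flatten (nseq N z0) ++ z1 ++ z0) ->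
  `|cross z1 z0| <= (gcdn (up z0) (dn z0))%:Z.
Proof.
move=> a0 c0 hN bal.
set g := gcdn _ _.
have [g0|g0] := posnP g.
  have /andP[/eqP u0 /eqP d0] : (up z0 == 0)%N && (dn z0 == 0)%N.
    by rewrite !eqn0Ngt -negb_or -gcdn_gt0 -/g g0.
  by rewrite crossE u0 d0 !mulr0 subr0.
have [i hi] : exists i, up z0 = (g * i)%N.
  by exists (up z0 %/ g)%N; rewrite mulnC divnK // dvdn_gcdl.
have [j hj] : exists j, dn z0 = (g * j)%N.
  by exists (dn z0 %/ g)%N; rewrite mulnC divnK // dvdn_gcdr.
have cij : coprime i j.
  have : gcdn (g * i) (g * j) = g by rewrite -hi -hj.
  by rewrite -muln_gcdr => /eqP; rewrite -{2}(muln1 g) eqn_pmul2l.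
have [l [l' hll]] := wide_prefixes g0 cij hi hj.
set s := (i + j)%N in hll *.
set H := height i%:Z j%:Z in hll *.
have hz0 : H z0 = 0 by rewrite /H /height hi hj !natz !PoszM; ring.
have crossH : cross z1 z0 = g%:Z * H z1.
  by rewrite crossE /H /height hi hj !natz !PoszM; ring.
have s0 : (0 < s)%N.
  by rewrite /s lt0n; apply: contraL cij => /eqP; case: (i) (j) => [|?] [|?].
pose eta : R := i%:R * c - j%:R * a.
have etaN : (N * g)%:R * `|eta| < a + c.
  have := bal [::] (flatten (nseq N z0)) (z1 ++ z0) erefl.
  rewrite height_power /height hi hj !natrM.
  have -> : g%:R * i%:R * c - g%:R * j%:R * a = g%:R * eta by rewrite /eta; ring.
  by rewrite -[(_ * eta) *+ N]mulr_natl mulrA normrM -natrM ger0_norm.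
(* The factors of [z0 ++ z1 ++ z0] also occur after [N - 1] copies of [z0]. *)
have narrow y s1 t1 : z0 ++ z1 ++ z0 = s1 ++ y ++ t1 -> `|H y| <= s%:Z.
  move=> hy.
  have szy : (size y <= N)%N.
    by apply: leq_trans hN; rewrite hy !size_cat addnCA leq_addr.
  have hby : `|height a c y| < a + c.
    case: (N) hN bal szy => [|N'] hN' bal' _.
      have : size y = 0%N by move: hN'; rewrite hy !size_cat; lia.
      by move/size0nil=> ->; rewrite height_nil normr0 addr_gt0.
    apply: (bal' (flatten (nseq N' z0) ++ s1) y t1).
    by rewrite -catA -hy powerSr -catA.
  have heq : (a + c) * (H y)%:~R = s%:R * height a c y - eta * (size y)%:R.
    rewrite /H height_intr /height /eta /s size_up_dn !natrD.
    ring.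
  have S0 : 0 < a + c by rewrite addr_gt0.
  have e1 : `|eta * (size y)%:R| < a + c.
    apply: le_lt_trans etaN; rewrite normrM mulrC (ger0_norm (ler0n _ _)).
    by rewrite ler_wpM2r // ler_nat (leq_trans szy) // leq_pmulr.
  have : (a + c) * `|H y|%:~R < (a + c) * (s%:Z + 1)%:~R.
    rewrite -{1}(ger0_norm (ltW S0)) intr_norm -normrM heq.
    apply: le_lt_trans (ler_normB _ _) _.
    rewrite normrM (ger0_norm (ler0n _ _)) intrD mulrDr mulr1.
    apply: ler_ltD => //.
    by rewrite mulrC -pmulrn ler_wpM2r // ltW.
  by rewrite ltr_pM2l // ltr_int; lia.
(* From a low point before [z1] to a high point after it. *)
have D1 : H z1 <= 1.
  have := @narrow (drop l z0 ++ z1 ++ take l' z0) (take l z0) (drop l' z0).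
  rewrite -!catA cat_take_drop (catA (take l z0)) cat_take_drop => /(_ erefl).
  have := height_cat i%:Z j%:Z (take l z0) (drop l z0).
  rewrite cat_take_drop -/H hz0 /H !height_cat -/H; lia.
(* From a high point before [z1] to a low point after it. *)
have D2 : -1 <= H z1.
  have := @narrow (drop l' z0 ++ z1 ++ take l z0) (take l' z0) (drop l z0).
  rewrite -!catA cat_take_drop (catA (take l' z0)) cat_take_drop => /(_ erefl).
  have := height_cat i%:Z j%:Z (take l' z0) (drop l' z0).
  rewrite cat_take_drop -/H hz0 /H !height_cat -/H; lia.
rewrite crossH normrM; nia.
Qed.

(** * From exchanges of three intervals to exchanges of two *)

(** B is read as A followed by C: the translation of B is the sum of those of A
    and C. *)
Definition sigma (X : letter) : seq bool :=
  match X with A => [:: true] | B => [:: true; false] | C => [:: false] end.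

Lemma iet_interval_disjoint (R : realType) b (al be ga x : R) X Y :
  0 < al -> 0 < be -> 0 < ga ->
  x \in iet_interval b al be ga X -> x \in iet_interval b al be ga Y -> X = Y.
Proof.
move=> al0 be0 ga0; rewrite /iet_interval /half_open; case: X Y => [] [] //;
  by case: b; rewrite !in_itv /= => /andP[h1 h2] /andP[h3 h4]; exfalso; lra.
Qed.

Lemma iet_step (R : realType) b (al be ga x : R) X :
  0 < al -> 0 < be -> 0 < ga -> x \in iet_interval b al be ga X ->
  iet b al be ga x = x + height (al + be) (be + ga) (sigma X).
Proof.
move=> al0 be0 ga0 xX; rewrite /iet.
have not_in Y : Y <> X -> (x \in iet_interval b al be ga Y) = false.
  move=> YX; apply/negP => xY; apply: YX.
  exact: iet_interval_disjoint al0 be0 ga0 xY xX.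
case: X xX not_in => xX not_in; rewrite ?xX ?not_in //;
  rewrite /height /=; ring.
Qed.

(** The second part says that the two halves of the move of B both stay in the
    domain of the exchange of two intervals, which is longer than that of the
    3iet by [be]. *)
Lemma iet_interval_lift (R : realType) b (al be ga x : R) X :
  0 < al -> 0 < be -> 0 < ga -> x \in iet_interval b al be ga X ->
  let D := half_open b 0 (al + be + (be + ga)) in
  x \in D /\ (X = B -> x + (be + ga) \in D).
Proof.
move=> al0 be0 ga0; rewrite /iet_interval /half_open.
case: X => xX; split=> //; move: xX;
  by case: b; rewrite !in_itv /= => /andP[h1 h2] *; apply/andP; split; lra.
Qed.

(** Every prefix of the binary word leads from [x m] to a point of a fixed
    half-open interval of length [a + c], so a factor, which is a difference of
    two prefixes, has a height below that length. *)
Lemma coding_balanced (R : realType) b (al be ga : R) (x : int -> R)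
    (v : biword) (f : seq letter) (m : int) :
  0 < al -> 0 < be -> 0 < ga ->
  (forall n : int, x (n + 1) = iet b al be ga (x n)) ->
  (forall n : int, x n \in iet_interval b al be ga (v n)) ->
  (forall k, (k < size f)%N -> v (m + k%:Z) = nth A f k) ->
  balanced (al + be) (be + ga) (flatten (map sigma f)).
Proof.
move=> al0 be0 ga0 xS xI vf.
set a := al + be; set c := be + ga.
have prefix_in s t : flatten (map sigma f) = s ++ t ->
    x m + height a c s \in half_open b 0 (a + c).
  elim: f m vf s => [|X f IH] m vf s /=.
    case: s => // _; rewrite height_nil addr0.
    by have [] := iet_interval_lift al0 be0 ga0 (xI m).
  have vm : v m = X by have := vf 0%N; rewrite addr0 => ->.
  have {}IH s' : flatten (map sigma f) = s' ++ t ->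
      x m + (height a c (sigma X ++ s')) \in half_open b 0 (a + c).
    move=> h; rewrite height_cat addrA -vm -[x m + _](iet_step al0 be0 ga0 (xI m)) -xS.
    apply: IH h => k kf; rewrite -[RHS](vf k.+1) //; congr v; lia.
  have [h1 h2] := iet_interval_lift al0 be0 ga0 (xI m); rewrite vm in h2.
  have h0 : x m + height a c [::] \in half_open b 0 (a + c).
    by rewrite height_nil addr0.
  have h3 : X = B -> x m + height a c [:: true] \in half_open b 0 (a + c).
    by move/h2; rewrite /height /= mul0r subr0 mul1r.
  case: X {vf vm h2} IH h3 => IH h3 /=.
  - by case: s => [|y s] // [<- /IH].
  - by case: s => [|y [|y' s]] // [<-] => [_|<- /IH //]; exact: h3.
  - by case: s => [|y s] // [<- /IH].
move=> s y t hz.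
have := prefix_in s (y ++ t) hz.
have := prefix_in (s ++ y) t; rewrite -catA => /(_ hz).
rewrite height_cat /half_open ltr_norml.
set h := height a c y; set h' := height a c s.
by case: (b); rewrite !in_itv /= => /andP[h1 h2] /andP[h3 h4];
  apply/andP; split; lra.
Qed.

(** * Periodicity and commensurable lengths *)
Lemma bounded_progression (R : realType) (S D : R) (f : nat -> R) :
  (forall n, 0 <= f n <= S) -> (forall k, f k.+1 = f k + D) -> D = 0.
Proof.
move=> fb fD.
have fk k : f k = f 0%N + k%:R * D.
  elim: k => [|k IH]; first by rewrite mul0r addr0.
  by rewrite fD IH -natr1; ring.
apply/eqP/negP => D0.
have nD : 0 < `|D| by rewrite normr_gt0; apply/negP.
have S0 : 0 <= S / `|D|.
  by have /andP[h1 h2] := fb 0%N; rewrite divr_ge0 // ; lra.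
have := archi_boundP S0; set k := Num.bound _.
rewrite ltr_pdivrMr // => hk.
have /andP[h1 h2] := fb k; have /andP[h3 h4] := fb 0%N.
have : `|k%:R * D| <= S by rewrite ler_norml; apply/andP; split; have := fk k; lra.
rewrite normrM ger0_norm //; lra.
Qed.

Lemma size_flatten_sigma f : (size f <= size (flatten (map sigma f)))%N.
Proof.
by elim: f => //= X f IH; rewrite size_cat -(add1n (size f)) leq_add //; case: X.
Qed.

(** Along a periodic coding the walk drifts by a constant amount per period;
    being bounded, it does not drift, and the vanishing height of a period is
    an integral relation between [a] and [c].  The factor [e] is 1 for the right
    half of a biinfinite word and -1 for the left half, which is walked
    backwards. *)
Lemma walk_aperiodic (R : realType) (a c S e : R) (f : nat -> R)
    (w : nat -> letter) :
  (forall i j : nat, i%:R * c = j%:R * a -> i = 0%N /\ j = 0%N) -> e != 0 ->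
  (forall n, 0 <= f n <= S) ->
  (forall n, f n.+1 = f n + e * height a c (sigma (w n))) ->
  ~ eventually_periodic w.
Proof.
move=> indep e0 fb fS [N [p [p0 wp]]].
have fp n : f (N + n + p)%N = f (N + n)%N + (f (N + p)%N - f N).
  elim: n => [|n IH]; first by rewrite addn0; ring.
  by rewrite addnS addSn !fS wp ?leq_addr // IH; ring.
have D0 : f (N + p)%N - f N = 0.
  apply: (@bounded_progression R S _ (fun k => f (N + k * p)%N)) => [n|k].
    exact: fb.
  by rewrite mulSn [(p + _)%N]addnC addnA fp.
pose z m := flatten (map sigma (mkseq (fun i => w (N + i)%N) m)).
have fz m : f (N + m)%N = f N + e * height a c (z m).
  elim: m => [|m IH]; first by rewrite addn0 height_nil mulr0 addr0.
  rewrite addnS fS IH /z [in RHS]mkseqS map_rcons flatten_rcons height_cat.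
  by ring.
have hz : height a c (z p) = 0.
  apply: (mulfI e0); rewrite mulr0; have := fz p.
  by move/eqP: D0; rewrite subr_eq0 => /eqP ->; lra.
move/eqP: hz; rewrite subr_eq0 => /eqP /indep [u0 d0].
have := size_flatten_sigma (mkseq (fun i => w (N + i)%N) p).
by rewrite -/(z p) size_up_dn u0 d0 size_mkseq; lia.
Qed.

(** When [a] and [c] are multiples of a common length [e], the orbit stays in
    the finite set of points of the domain that differ from [x 0] by a
    multiple of [e]; by pigeonhole it returns to a previous point, and from
    there on it repeats itself. *)
Lemma rational_coding_periodic (R : realType) b (al be ga : R) (x : int -> R)
    (v : biword) (d1 d2 : nat) :
  0 < al -> 0 < be -> 0 < ga ->
  (forall n : int, x (n + 1) = iet b al be ga (x n)) ->
  (forall n : int, x n \in iet_interval b al be ga (v n)) ->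
  (0 < d1 + d2)%N -> d1%:R * (be + ga) = d2%:R * (al + be) ->
  eventually_periodic (fun n : nat => v n%:Z).
Proof.
move=> al0 be0 ga0 xS xI d0 rat.
set a := al + be in rat *; set c := be + ga in rat *.
have a0 : 0 < a by rewrite addr_gt0.
have c0 : 0 < c by rewrite addr_gt0.
have d10 : (0 < d1)%N.
  case: (d1) d0 rat => // d0; rewrite mul0r => /esym/eqP.
  by rewrite mulf_eq0 (gt_eqF a0) orbF pnatr_eq0; lia.
pose e := a / d1%:R.
have e0 : 0 < e by rewrite divr_gt0 // ltr0n.
have ea : a = d1%:R * e by rewrite /e mulrC divfK // pnatr_eq0 -lt0n.
have ec : c = d2%:R * e.
  by apply: (@mulfI _ d1%:R); rewrite ?pnatr_eq0 -?lt0n // rat ea; ring.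
have xn (n : nat) : x n.+1%:Z = x n%:Z + height a c (sigma (v n%:Z)).
  by rewrite -addn1 PoszD xS (iet_step al0 be0 ga0 (xI n)).
pose K n : int :=
  height d1%:Z d2%:Z (flatten (map sigma (mkseq (fun i => v i%:Z) n))).
have xK n : x n%:Z = x 0 + (K n)%:~R * e.
  elim: n => [|n IH]; first by rewrite /K height_nil mul0r addr0.
  rewrite xn IH /K !height_intr mkseqS map_rcons flatten_rcons height_cat.
  have -> : height a c (sigma (v n%:Z)) = height d1%:R d2%:R (sigma (v n%:Z)) * e.
    by rewrite /height ea ec; ring.
  by ring.
have xb n : 0 <= x n <= a + c.
  have [] := iet_interval_lift al0 be0 ga0 (xI n).
  by rewrite /half_open -/a -/c; case: (b); rewrite in_itv /= => /andP[h1 h2] _;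
    apply/andP; split; lra.
have S0 : 0 <= (a + c) / e by rewrite divr_ge0 ?ltW // addr_gt0.
have [Q KQ] : exists Q : nat, forall n, `|K n| <= Q%:Z.
  exists (Num.bound ((a + c) / e)) => n.
  rewrite -(ler_int R) intr_norm -pmulrn; apply/ltW.
  apply: le_lt_trans (archi_boundP S0); rewrite ler_pdivlMr //.
  rewrite -{1}(ger0_norm (ltW e0)) -normrM ler_norml.
  have := xK n; have /andP[h1 h2] := xb n; have /andP[h3 h4] := xb 0.
  by move=> h5; apply/andP; split; lra.
(* [Q + Q + 2] values of [K], all between [- Q] and [Q]. *)
pose s := map K (iota 0 (Q + Q).+2).
have : ~~ uniq s.
  apply/negP => /uniq_leq_size us.
  have := us [seq k%:Z - Q%:Z | k <- iota 0 (Q + Q).+1].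
  rewrite !size_map !size_iota ltnn => h; apply/notF/h => {h}.
  move=> y /mapP[n _ ->] {us}; apply/mapP; exists (absz (K n + Q%:Z)).
    by rewrite mem_iota; have := KQ n; lia.
  by have := KQ n; lia.
case/(uniqPn 0) => i [j [ij]]; rewrite size_map size_iota => js.
rewrite !(nth_map 0%N) ?size_iota //; last exact: ltn_trans js.
rewrite !nth_iota // ?(ltn_trans ij) // !add0n => Kij.
have xij n : x (i + n)%:Z = x (j + n)%:Z.
  elim: n => [|n IH]; first by rewrite !addn0 (xK i) (xK j) Kij.
  by rewrite !addnS -(addn1 (i + n)) -(addn1 (j + n)) !(PoszD _ 1) !xS IH.
exists i, (j - i)%N; split=> [|n ni]; first by rewrite subn_gt0.
apply: (iet_interval_disjoint al0 be0 ga0 (xI _)).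
have -> : (n + (j - i) = j + (n - i))%N by lia.
by rewrite -xij subnKC.
Qed.

(** * Test words *)
Definition iet_inv (R : realType) (al be ga y : R) : R :=
  if y < ga then y + al + be
  else if y < ga + be then y + al - ga else y - be - ga.

Lemma iet_inv_spec (R : realType) (al be ga y : R) :
  0 < al -> 0 < be -> 0 < ga -> 0 <= y < al + be + ga ->
  0 <= iet_inv al be ga y < al + be + ga /\
  iet true al be ga (iet_inv al be ga y) = y.
Proof.
move=> al0 be0 ga0 /andP[y0 yS]; rewrite /iet_inv.
have use (X : letter) z : z \in iet_interval true al be ga X ->
    z + height (al + be) (be + ga) (sigma X) = y ->
    0 <= z < al + be + ga /\ iet true al be ga z = y.
  move=> zX zy; rewrite (iet_step al0 be0 ga0 zX) zy; split=> //.
  move: zX; rewrite /iet_interval /half_open.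
  by case: (X); rewrite in_itv /= => /andP[h1 h2]; lra.
case: ltP => h1; [|case: ltP => h2].
- by apply: (use C); rewrite ?in_itv /height /=; [apply/andP; split|]; lra.
- by apply: (use B); rewrite ?in_itv /height /=; [apply/andP; split|]; lra.
- by apply: (use A); rewrite ?in_itv /height /=; [apply/andP; split|]; lra.
Qed.

Definition letter_at (R : realType) (al be y : R) : letter :=
  if y < al then A else if y < al + be then B else C.

Lemma letter_atP (R : realType) (al be ga y : R) : 0 <= y < al + be + ga ->
  y \in iet_interval true al be ga (letter_at al be y).
Proof.
move=> /andP[y0 yS]; rewrite /letter_at /iet_interval /half_open.
by case: ltP => h1; [|case: ltP => h2]; rewrite in_itv /=; apply/andP; split; lra.
Qed.

Lemma iet_stable (R : realType) (al be ga y : R) :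
  0 < al -> 0 < be -> 0 < ga -> 0 <= y < al + be + ga ->
  0 <= iet true al be ga y < al + be + ga.
Proof.
move=> al0 be0 ga0 hy; have hX := letter_atP hy.
rewrite (iet_step al0 be0 ga0 hX); move: hX.
rewrite /iet_interval /half_open /height.
case: letter_at; rewrite in_itv /= => /andP[h1 h2]; lra.
Qed.

(** The orbit is continued to the past by iterating the inverse
    transformation. *)
Lemma iet_word_exists (R : realType) (al be ga x0 : R) :
  0 < al -> 0 < be -> 0 < ga -> 0 <= x0 < al + be + ga ->
  (forall i j : nat, i%:R * (be + ga) = j%:R * (al + be) ->
     i = 0%N /\ j = 0%N) ->
  exists (u : biword) (x : int -> R), [/\ iet_word R u, x 0 = x0,
    forall n : int, x (n + 1) = iet true al be ga (x n) &
    forall n : int, x n \in iet_interval true al be ga (u n)].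
Proof.
move=> al0 be0 ga0 x0D indep.
pose T := iet true al be ga; pose Ti := iet_inv al be ga.
pose x (n : int) := match n with
  | Posz m => iter m T x0 | Negz m => iter m.+1 Ti x0 end.
have fwd m : 0 <= iter m T x0 < al + be + ga.
  by elim: m => //= m; exact: iet_stable.
have bwd m : 0 <= iter m Ti x0 < al + be + ga.
  by elim: m => //= m /(iet_inv_spec al0 be0 ga0)[].
have xD n : 0 <= x n < al + be + ga by case: n => m; [exact: fwd|exact: bwd].
have xS n : x (n + 1) = T (x n).
  case: n => [m|[|m]]; first by rewrite -PoszD addn1.
  - by rewrite /= /T; have [_ ->] := iet_inv_spec al0 be0 ga0 x0D.
  - have -> : Negz m.+1 + 1 = Negz m by lia.
    by rewrite /= /T; have [_ ->] := iet_inv_spec al0 be0 ga0 (bwd m.+1).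
pose u n := letter_at al be (x n).
have xI n : x n \in iet_interval true al be ga (u n) by exact: letter_atP.
have xW n : x (n + 1) = x n + height (al + be) (be + ga) (sigma (u n)).
  by rewrite xS; exact: iet_step (xI n).
have xb n : 0 <= x n <= al + be + ga.
  by have /andP[h1 h2] := xD n; rewrite h1 ltW.
exists u, x; split=> //; split; last first.
  exists true, al, be, ga, x0; split=> //; first by exists (u 0); exact: (xI 0).
  by exists x => //; split=> // n; exists (u n).
split.
- apply: (@walk_aperiodic R _ _ (al + be + ga) 1 (fun n => x n%:Z) _ indep).
  + exact: oner_neq0.
  + by move=> n; exact: xb.
  + by move=> n; rewrite mul1r -xW -PoszD addn1.
- apply: (@walk_aperiodic R _ _ (al + be + ga) (-1) (fun n => x (- n%:Z)) _ indep).
  + by rewrite oppr_eq0 oner_neq0.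
  + by move=> n; exact: xb.
  + move=> n; have := xW (- n.+1%:Z).
    have -> : - n.+1%:Z + 1 = - n%:Z by lia.
    by move=> ->; ring.
Qed.

Lemma sqrt2_irrational (R : realType) (p q : int) :
  p%:~R * Num.sqrt 2 = q%:~R :> R -> p = 0.
Proof.
move=> /(congr1 (fun t => t ^+ 2)); rewrite exprMn sqr_sqrtr ?ler0n // => h.
have {}h : (`|p| ^ 2 * 2 = `|q| ^ 2)%N.
  have : (p ^+ 2 * 2)%:~R = (q ^+ 2)%:~R :> R by rewrite intrM !rmorphXn.
  by move/eqP; rewrite eqr_int => /eqP; lia.
apply/eqP; rewrite -absz_eq0; apply: contraTT isT => p0.
have pp : (0 < `|p|)%N by rewrite lt0n.
have qp : (0 < `|q|)%N.
  by rewrite lt0n; apply: contraTneq pp => q0; move: h; rewrite q0; lia.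
have := congr1 (logn 2) h; rewrite lognM ?expn_gt0 ?pp // !lognX.
rewrite [logn 2 2]logn_prime //=; lia.
Qed.

(** The orbit of [x] starts by following the letters of [w], which takes it to
    [y]. *)
Fixpoint itinerary (R : realType) (al be ga x : R) (w : seq letter) (y : R) :=
  if w is X :: w' then
    x \in iet_interval true al be ga X /\
    itinerary al be ga (iet true al be ga x) w' y
  else x = y.

Lemma itinerary_cat (R : realType) (al be ga x y z : R) w w' :
  itinerary al be ga x w y -> itinerary al be ga y w' z ->
  itinerary al be ga x (w ++ w') z.
Proof.
by elim: w x => [|X w IH] x /=; [move=> -> | case=> ? h1 h2; split=> //; exact: IH].
Qed.

Lemma itinerary_iter (R : realType) (al be ga x d : R) w N :
  (forall i : nat, (i < N)%N ->
     itinerary al be ga (x + i%:R * d) w (x + i.+1%:R * d)) ->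
  itinerary al be ga x (flatten (nseq N w)) (x + N%:R * d).
Proof.
elim: N => [|N IH] h; first by rewrite /= mul0r addr0.
rewrite powerSr; apply: itinerary_cat (h N _) => //.
by apply: IH => i iN; apply: h; exact: ltnW.
Qed.

Lemma itinerary_coding (R : realType) (al be ga : R) (x : int -> R)
    (u : biword) (w : seq letter) (m : int) (y : R) :
  0 < al -> 0 < be -> 0 < ga ->
  (forall n : int, x (n + 1) = iet true al be ga (x n)) ->
  (forall n : int, x n \in iet_interval true al be ga (u n)) ->
  itinerary al be ga (x m) w y ->
  forall k, (k < size w)%N -> u (m + k%:Z) = nth A w k.
Proof.
move=> al0 be0 ga0 xS xI; elim: w m => // X w IH m [xX] /=.
rewrite -xS => /IH {}IH [|k] kw.
  by rewrite addr0; apply: iet_interval_disjoint (xI m) xX.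
by rewrite -[RHS](IH k) //; congr u; lia.
Qed.

Lemma itinerary_As (R : realType) (al be ga x y : R) j :
  0 < al -> 0 < be -> 0 < ga -> 0 <= x ->
  y = x + j%:R * (be + ga) -> y < al + (be + ga) ->
  itinerary al be ga x (nseq j A) y.
Proof.
move=> al0 be0 ga0; elim: j x y => [|j IH] x y x0 ->; first by rewrite mul0r addr0.
rewrite -natr1 => hx /=.
have jc : 0 <= j%:R * (be + ga) by rewrite mulr_ge0 ?ler0n //; lra.
have xA : x \in iet_interval true al be ga A.
  by rewrite /iet_interval /half_open in_itv /=; apply/andP; split; lra.
split=> //; rewrite (iet_step al0 be0 ga0 xA) /height /=.
apply: IH; [lra|ring|lra].
Qed.

(** The parameters are chosen so that the first return to the union of the
    intervals of B and C, seen from its left end [al], is the rotation by 1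
    modulo [be + ga]: a point of B or C is sent below [be + ga] and then climbs
    through A by steps of [be + ga].  Starting from the left end, the orbit
    spends [N = be] rounds in B and [k] rounds in C; the rotation then wraps
    around, in a round with one A less, and comes back to B because [0 < r < 1]. *)
Lemma test_itinerary (R : realType) (al be ga r : R) (n k N : nat) :
  0 < al -> 0 < r < 1 -> (0 < k)%N -> (0 < N)%N ->
  be = N%:R -> ga = k%:R + r -> al = n%:R * (be + ga) + ga - 1 ->
  exists y, itinerary al be ga al
    (flatten (nseq N (B :: nseq n A)) ++
       (flatten (nseq k (C :: nseq n.+1 A)) ++ (C :: nseq n A)) ++
       (B :: nseq n A)) y.
Proof.
move=> al0 /andP[r0 r1] k0 N0 hbe hga hal.
have be1 : 1 <= be by rewrite hbe ler1n.
have k1 : 1 <= k%:R :> R by rewrite ler1n.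
have be0 : 0 < be by lra.
have ga0 : 0 < ga by lra.
have runB x : al <= x -> x < al + be ->
    itinerary al be ga x (B :: nseq n A) (x + 1).
  move=> h1 h2; have xB : x \in iet_interval true al be ga B.
    by rewrite /iet_interval /half_open in_itv /=; apply/andP; split.
  split=> //; rewrite (iet_step al0 be0 ga0 xB) /height /=.
  by apply: itinerary_As => //; lra.
have runC x : al + be <= x -> x < al + be + ga - 1 ->
    itinerary al be ga x (C :: nseq n.+1 A) (x + 1).
  move=> h1 h2; have xC : x \in iet_interval true al be ga C.
    by rewrite /iet_interval /half_open in_itv /=; apply/andP; split; lra.
  have xT : iet true al be ga x = x - (al + be).
    by rewrite (iet_step al0 be0 ga0 xC) /height /=; ring.
  split=> //; rewrite xT.
  by apply: itinerary_As => //; rewrite -?natr1; lra.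
have runC' x : al + be + ga - 1 <= x -> x < al + be + ga ->
    itinerary al be ga x (C :: nseq n A) (x + 1 - (be + ga)).
  move=> h1 h2; have xC : x \in iet_interval true al be ga C.
    by rewrite /iet_interval /half_open in_itv /=; apply/andP; split; lra.
  split=> //; rewrite (iet_step al0 be0 ga0 xC) /height /=.
  by apply: itinerary_As => //; lra.
pose y1 := al + N%:R * 1; pose y2 := y1 + k%:R * 1.
exists (y2 + 1 - (be + ga) + 1).
apply: (@itinerary_cat _ _ _ _ _ y1).
  apply: itinerary_iter => i iN; rewrite -natr1 mulrDl mul1r mulr1 addrA.
  have : i.+1%:R <= be :> R by rewrite hbe ler_nat.
  by rewrite -natr1 => h; have := ler0n R i; move=> ?; apply: runB; lra.
apply: (@itinerary_cat _ _ _ _ _ (y2 + 1 - (be + ga))).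
  apply: (@itinerary_cat _ _ _ _ _ y2).
    apply: itinerary_iter => i ik; rewrite -natr1 mulrDl mul1r mulr1 addrA.
    have : i.+1%:R <= k%:R :> R by rewrite ler_nat.
    rewrite -natr1 => h; have := ler0n R i; move=> ?.
    by apply: runC; rewrite /y1; lra.
  by apply: runC'; rewrite /y2 /y1; lra.
by apply: runB; rewrite /y2 /y1; lra.
Qed.

(** Taking [r = sqrt 2 - 1] in [test_itinerary] makes [al + be] and [be + ga]
    incommensurable, hence the coding aperiodic. *)
Lemma test_word (R : realType) (n k N : nat) : (0 < k)%N -> (0 < N)%N ->
  let w := flatten (nseq N (B :: nseq n A)) ++
       (flatten (nseq k (C :: nseq n.+1 A)) ++ (C :: nseq n A)) ++
       (B :: nseq n A) in
  exists2 u : biword, iet_word R u &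
    forall i, (i < size w)%N -> u i%:Z = nth A w i.
Proof.
move=> k0 N0 w.
pose q : R := Num.sqrt 2.
have q2 : q ^+ 2 = 2 by rewrite sqr_sqrtr ?ler0n.
have q0 : 0 <= q by exact: sqrtr_ge0.
have r0 : 0 < q - 1 by nra.
have r1 : q - 1 < 1 by nra.
pose be : R := N%:R; pose ga : R := k%:R + (q - 1).
pose al : R := n%:R * (be + ga) + ga - 1.
have k1 : 1 <= k%:R :> R by rewrite ler1n.
have be0 : 0 < be by rewrite ltr0n.
have ga1 : 1 < ga by rewrite /ga; lra.
have ga0 : 0 < ga by apply: lt_trans ga1.
have al0 : 0 < al.
  by rewrite /al -addrA ltr_wpDl ?subr_gt0 // mulr_ge0 ?ler0n // ltW // addr_gt0.
have [||u [x [uW x0 xS xI]]] := @iet_word_exists R al be ga al al0 be0 ga0.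
- by rewrite ltW //= -addrA ltrDl addr_gt0.
- move=> i j hij.
  have hD : (i%:Z - (j * n.+1)%N%:Z)%:~R * q =
     (- j%:Z - (i%:Z - (j * n.+1)%N%:Z) * (N%:Z + k%:Z - 1))%:~R.
    move: hij; rewrite /al /be /ga PoszM -addn1 PoszD => hij.
    rewrite !(intrB, intrD, intrM, intrN) -!pmulrn.
    lra.
  have D0 := sqrt2_irrational hD.
  move: hD; rewrite D0 !mul0r subr0 => /eqP; rewrite eq_sym intr_eq0; lia.
have [|y hy] :=
  @test_itinerary R al be ga (q - 1) n k N al0 _ k0 N0 erefl erefl erefl.
  by rewrite r0 r1.
exists u => // i iw; rewrite -[i%:Z]add0r.
by apply: (itinerary_coding al0 be0 ga0 xS xI (y := y)) iw; rewrite x0.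
Qed.

(** * The image walks of a preserving morphism *)

(** The image of a factor of [u] is a factor of [v], at the position of its
    first block. *)
Lemma image_factor (phi : morphism3) (u v : biword) (p : int -> int) w i :
  (forall i : int, p (i + 1) = p i + (size (phi (u i)))%:Z) ->
  (forall (i : int) (k : nat), (k < size (phi (u i)))%N ->
     v (p i + k%:Z) = nth A (phi (u i)) k) ->
  (forall k, (k < size w)%N -> u (i + k%:Z) = nth A w k) ->
  forall k, (k < size (flatten (map phi w)))%N ->
    v (p i + k%:Z) = nth A (flatten (map phi w)) k.
Proof.
move=> pS pv; elim: w i => // X w IH i uw k /=.
have ui : u i = X by have := uw 0%N; rewrite addr0 => ->.
rewrite size_cat nth_cat -ui.
case: (ltnP k (size (phi (u i)))) => [kX _|kX kw]; first exact: pv.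
rewrite -(IH (i + 1)) ?ltn_subLR //; first by rewrite pS; congr v; lia.
by move=> l lw; rewrite -[RHS](uw l.+1) //; congr u; lia.
Qed.

Definition image_walk (phi : morphism3) (X : letter) : seq bool :=
  flatten (map sigma (phi X)).

Lemma flatten_image_walk (phi : morphism3) w :
  flatten (map sigma (flatten (map phi w))) = flatten (map (image_walk phi) w).
Proof. by elim: w => //= X w IH; rewrite map_cat flatten_cat IH. Qed.

Lemma flatten_map_power (f : letter -> seq bool) N w :
  flatten (map f (flatten (nseq N w))) = flatten (nseq N (flatten (map f w))).
Proof. by elim: N => //= N IH; rewrite map_cat flatten_cat IH. Qed.

(** The image walk of [X A^m]. *)
Definition block (phi : morphism3) (X : letter) (m : nat) : seq bool :=
  image_walk phi X ++ flatten (nseq m (image_walk phi A)).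

(** [balanced_cross] applied to the image of [test_word].  The bound does not
    depend on [k], so the coefficient of [k] has to vanish. *)
Lemma test_cross (R : realType) (phi : morphism3) (n k : nat) :
  iet_preserving R phi -> (0 < k)%N ->
  `|cross (block phi C n.+1) (block phi B n) *+ k
      + cross (block phi C n) (block phi B n)|
     <= (gcdn (up (block phi B n)) (dn (block phi B n)))%:Z.
Proof.
move=> pres k0; set loop := block phi; set z := loop B n.
have loopE X m : loop X m = flatten (map (image_walk phi) (X :: nseq m A)).
  by rewrite /loop /block /= map_nseq.
pose z1 := flatten (nseq k (loop C n.+1)) ++ loop C n.
pose N := (size (z ++ z1 ++ z)).+1.
have [u uW uw] := @test_word R n k N k0 isT.
have [v [p [p0 pS pv _]] [_ [b [al [be [ga [x0 par]]]]]]] := pres u uW.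
case: par => al0 be0 ga0 _ [x [_ _ xS] xI].
have := @image_factor phi u v p _ 0 pS pv.
move=> /(_ _ (fun k kw => etrans (congr1 u (add0r _)) (uw k kw))) vf.
have := coding_balanced al0 be0 ga0 xS xI vf.
rewrite flatten_image_walk !map_cat !flatten_cat !flatten_map_power -!loopE -/z.
have a0 : 0 < al + be by rewrite addr_gt0.
have c0 : 0 < be + ga by rewrite addr_gt0.
move=> /(@balanced_cross R _ _ z z1 N a0 c0 (leqnSn _)).
by rewrite /z1 cross_catl cross_powerl.
Qed.

(** Both gcds divide the determinant [l], so for [l] nonzero the bounds make them
    equal to [|l|].  Then [|l|] divides all four entries and [l ^ 2] divides
    [l]. *)
Lemma unimodular_pair (uA dA uB dB : nat) :
  let l : int := uA%:Z * dB%:Z - dA%:Z * uB%:Z in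
  `|l| <= (gcdn uB dB)%:Z -> `|l| <= (gcdn (uB + uA) (dB + dA))%:Z ->
  l = 0 \/ l = 1 \/ l = -1.
Proof.
move=> l h1 h2; have [l0|l0] := eqVneq l 0; [by left|right].
set m := absz l; have m0 : (0 < m)%N by rewrite absz_gt0.
(* A divisor of [l] that is at least [m] equals [m]. *)
have max_div (g : nat) (t : int) : l = g%:Z * t -> `|l| <= g%:Z -> g = m.
  move=> h hg; have t0 : t != 0 by apply: contraNneq l0 => t0; rewrite h t0 mulr0.
  have : m = (g * absz t)%N by rewrite /m h abszM absz_nat.
  have : (0 < absz t)%N by rewrite absz_gt0.
  have : (m <= g)%N by rewrite /m; lia.
  nia.
have [g1u g1d] : (m %| uB)%N /\ (m %| dB)%N.
  have [b1 hb1] := dvdnP (dvdn_gcdl uB dB).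
  have [b2 hb2] := dvdnP (dvdn_gcdr uB dB).
  rewrite -(max_div _ (uA%:Z * b2%:Z - dA%:Z * b1%:Z) _ h1) ?dvdn_gcdl ?dvdn_gcdr //.
  by rewrite /l {1}hb1 {1}hb2 !PoszM; ring.
have [g2u g2d] : (m %| uB + uA)%N /\ (m %| dB + dA)%N.
  have [b1 hb1] := dvdnP (dvdn_gcdl (uB + uA) (dB + dA)).
  have [b2 hb2] := dvdnP (dvdn_gcdr (uB + uA) (dB + dA)).
  rewrite -(max_div _ (uA%:Z * b2%:Z - dA%:Z * b1%:Z) _ h2) ?dvdn_gcdl ?dvdn_gcdr //.
  have -> : l = uA%:Z * (dB + dA)%:Z - dA%:Z * (uB + uA)%:Z.
    by rewrite /l !PoszD; ring.
  by rewrite {1}hb1 {1}hb2 !PoszM; ring.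
rewrite (dvdn_addr _ g1u) in g2u; rewrite (dvdn_addr _ g1d) in g2d.
case/dvdnP: g1u g1d => b1 hb1 /dvdnP[b2 hb2].
case/dvdnP: g2u g2d => a1 ha1 /dvdnP[a2 ha2].
pose t : int := a1%:Z * b2%:Z - a2%:Z * b1%:Z.
have lt : l = m%:Z * m%:Z * t by rewrite /l /t ha1 ha2 hb1 hb2 !PoszM; ring.
have : m = (m * m * absz t)%N by rewrite {1}/m lt !abszM !absz_nat.
suff : m = (m * m * absz t)%N -> m = 1%N by rewrite /m; lia.
by case: (absz t) => [|q]; nia.
Qed.

(** With [a, b, c] the count vectors of the three image walks, the case [n = 0]
    of [test_cross] says that [det (c + a, b) = 0] and bounds [det (c, b)]; the
    case [n = 1] says that [det (c + 2 a, b + a) = 0] and bounds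
    [det (c + a, b + a)]. *)
Lemma cross_relations (R : realType) (phi : morphism3) :
  iet_preserving R phi ->
  let l := cross (image_walk phi A) (image_walk phi B) in
  [/\ cross (image_walk phi A) (image_walk phi C) = l,
      cross (image_walk phi B) (image_walk phi C) = l &
      l = 0 \/ l = 1 \/ l = -1].
Proof.
move=> pres l.
(* A linear function of [k] that stays bounded is constant. *)
have sep (D1 D0 : int) (g : nat) :
    (forall k, (0 < k)%N -> `|D1 *+ k + D0| <= g%:Z) -> D1 = 0 /\ `|D0| <= g%:Z.
  move=> h; have D10 : D1 = 0.
    have := h (absz D0 + g + 1)%N; rewrite addn1 => /(_ isT).
    rewrite -mulr_natl natz; nia.
  by split=> //; have := h 1%N isT; rewrite D10 mul0rn add0r.
have [] := sep _ _ _ (fun k => @test_cross R phi 0 k pres).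
rewrite /block /= ?cats0 => e1 e2.
have [] := sep _ _ _ (fun k => @test_cross R phi 1 k pres).
rewrite /block /= ?cats0 => e3 e4.
set zA := image_walk phi A in l e1 e2 e3 e4 *.
set zB := image_walk phi B in l e1 e2 e3 e4 *.
set zC := image_walk phi C in e1 e2 e3 e4 *.
have anti x y : cross x y = - cross y x by rewrite !crossE; ring.
have self x : cross x x = 0 by rewrite crossE; ring.
rewrite !(cross_catl, cross_catr) self in e1 e3 e4.
rewrite -/l (anti zC zB) (anti zC zA) in e1 e2 e3 e4.
have bc : cross zB zC = l by lia.
have ac : cross zA zC = l by lia.
split=> //; rewrite /l crossE; apply: unimodular_pair; rewrite -crossE -/l.
- by move: e2; rewrite bc normrN.
- by move: e4; rewrite bc ac up_cat dn_cat; lia.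
Qed.

(** If all image walks were multiples of a direction [(d1, d2)], the height of
    the image of a long factor would be its length times a constant multiple
    of [eta := d1 c - d2 a].  Images of factors are arbitrarily long, so balance
    forces [eta = 0]. *)
Lemma image_walks_not_parallel (R : realType) (phi : morphism3) :
  iet_preserving R phi ->
  ~ (forall X Y, cross (image_walk phi X) (image_walk phi Y) = 0).
Proof.
move=> pres par.
have [d1 [d2 [d0 hd]]] : exists d1 d2 : nat, (0 < d1 + d2)%N /\
    forall X, (up (image_walk phi X) * d2 = dn (image_walk phi X) * d1)%N.
  have [allnil|/forallPn[X hX]] := boolP [forall X, size (image_walk phi X) == 0%N].
    (* Every direction fits when all image walks are empty. *)
    exists 1%N, 1%N; split=> // X.
    by have := forallP allnil X; rewrite size_up_dn; lia.
  exists (up (image_walk phi X)), (dn (image_walk phi X)).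
  split=> [|Y]; first by rewrite -size_up_dn lt0n.
  by have := par Y X; rewrite crossE; lia.
have [u uW _] := @test_word R 0 1 1 isT isT.
have [v [p [p0 pS pv pcov]] [[v_aper _] [b [al [be [ga [x0 par_v]]]]]]] := pres u uW.
case: par_v => al0 be0 ga0 _ [x [_ _ xS] xI].
set S := (al + be) + (be + ga).
have S0 : 0 < S by rewrite !addr_gt0.
pose eta := d1%:R * (be + ga) - d2%:R * (al + be).
pose z n := flatten (map (image_walk phi) (mkseq (fun i : nat => u i) n)).
pose f n := flatten (map phi (mkseq (fun i : nat => u i) n)).
have pf n : p n%:Z = (size (f n))%:Z.
  elim: n => // n IH.
  rewrite -addn1 PoszD pS IH addn1 /f mkseqS map_rcons flatten_rcons size_cat.
  by rewrite PoszD.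
have zf n : z n = flatten (map sigma (f n)) by rewrite flatten_image_walk.
have bal n : `|height (al + be) (be + ga) (z n)| < S.
  suff zbal : balanced (al + be) (be + ga) (z n).
    by apply: (zbal [::] (z n) [::]); rewrite cats0.
  rewrite zf; apply: (coding_balanced al0 be0 ga0 xS xI (m := p 0)).
  apply: (image_factor pS pv (i := 0)) => k; rewrite size_mkseq => kn.
  by rewrite add0r nth_mkseq.
have zpar n : (up (z n) * d2 = dn (z n) * d1)%N.
  rewrite /z; elim: (mkseq _ n) => //= X w IH.
  by rewrite up_cat dn_cat !mulnDl IH hd.
have hz n :
    (d1 + d2)%:R * height (al + be) (be + ga) (z n) = (size (z n))%:R * eta.
  have : (up (z n))%:R * d2%:R = (dn (z n))%:R * d1%:R :> R.
    by rewrite -!natrM zpar.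
  rewrite size_up_dn /height /eta !natrD => h.
  set U := (up _)%:R in h *; set V := (dn _)%:R in h *.
  suff: (U * d2%:R - V * d1%:R) * (be + ga + (al + be)) = 0 by move=> h'; lra.
  by rewrite h subrr mul0r.
have p_neg (m : nat) : p (- m%:Z) <= 0.
  elim: m => [|m IH]; first by rewrite p0.
  have := pS (- m.+1%:Z); have -> : - m.+1%:Z + 1 = - m%:Z by lia.
  lia.
have size_z n : (size (f n) <= size (z n))%N by rewrite zf size_flatten_sigma.
have unbounded M : exists n, (M < size (z n))%N.
  have [i /andP[_ hi]] := pcov M%:Z.
  case: (lerP 0 (i + 1)) => i0; last first.
    have := p_neg (absz (i + 1)); have -> : - (absz (i + 1))%:Z = i + 1 by lia.
    lia.
  exists (absz (i + 1)); apply: leq_trans (size_z _).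
  have := pf (absz (i + 1)); have -> : (absz (i + 1))%:Z = i + 1 by lia.
  lia.
have eta0 : eta = 0.
  apply/eqP; apply: contraTT isT => eta0.
  have neta : 0 < `|eta| by rewrite normr_gt0.
  have B0 : 0 <= (d1 + d2)%:R * S / `|eta|.
    by rewrite divr_ge0 // mulr_ge0 ?ler0n // ltW.
  have [n hn] := unbounded (Num.bound ((d1 + d2)%:R * S / `|eta|)).
  have : (size (z n))%:R * `|eta| < (size (z n))%:R * `|eta|.
    rewrite -{1}[(size _)%:R]ger0_norm ?ler0n // -normrM -hz normrM ger0_norm ?ler0n //.
    apply: (@lt_trans _ _ ((d1 + d2)%:R * S)); first by rewrite ltr_pM2l ?ltr0n.
    rewrite -ltr_pdivrMr //; apply: lt_trans (archi_boundP B0) _.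
    by rewrite ltr_nat.
  by rewrite ltxx.
apply: v_aper; apply: (rational_coding_periodic al0 be0 ga0 xS xI d0).
by apply/eqP; rewrite -subr_eq0 -/eta eta0.
Qed.

(** E is the pullback of the determinant form of the plane under the projection
    that sends B to the sum of A and C. *)
Lemma cross_incidence (phi : morphism3) (i j : 'I_3) :
  let M : 'M[int]_3 := map_mx Posz (incidence_matrix phi) in
  (M *m E *m M^T) i j =
  cross (image_walk phi (letter_of_ord i)) (image_walk phi (letter_of_ord j)).
Proof.
move=> M.
have up_sigma (f : seq letter) :
    (up (flatten (map sigma f)) = count_mem A f + count_mem B f)%N.
  by elim: f => //= X f; rewrite up_cat => ->; case: X; rewrite /up /=; lia.
have dn_sigma (f : seq letter) :
    (dn (flatten (map sigma f)) = count_mem B f + count_mem C f)%N.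
  by elim: f => //= X f; rewrite dn_cat => ->; case: X; rewrite /dn /=; lia.
rewrite crossE /image_walk !up_sigma !dn_sigma.
rewrite !mxE !big_ord_recl big_ord0 !mxE !big_ord_recl !big_ord0 !mxE /=.
by rewrite /letter_of_ord /=; ring.
Qed.

Theorem theoremA (R : realType) (phi : morphism3)
    (hphi : iet_preserving R phi) :
  let M : 'M[int]_3 := map_mx Posz (incidence_matrix phi) in
  M *m E *m M^T = E \/ M *m E *m M^T = - E.
Proof.
move=> M; have [] := cross_relations hphi.
set l := cross (image_walk phi A) (image_walk phi B) => ac bc l_unit.
have anti X Y : cross (image_walk phi X) (image_walk phi Y) =
    - cross (image_walk phi Y) (image_walk phi X) by rewrite !crossE; ring.
have self X : cross (image_walk phi X) (image_walk phi X) = 0.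
  by rewrite crossE; ring.
have cross_E i j : (M *m E *m M^T) i j = l * E i j.
  rewrite cross_incidence mxE.
  by case: i j => [[|[|[|//]]] ?] [[|[|[|//]]] ?]; rewrite /letter_of_ord /=
    ?self ?(anti B A) ?(anti C A) ?(anti C B) ?ac ?bc -/l; ring.
case: l_unit => [l0 | [l1 | l1]].
- case: (image_walks_not_parallel hphi) => X Y.
  have := cross_E (ord_of_letter X) (ord_of_letter Y).
  by rewrite l0 mul0r cross_incidence !ord_of_letterK.
- by left; apply/matrixP => i j; rewrite cross_E l1 mul1r.
- by right; apply/matrixP => i j; rewrite cross_E l1 mulN1r [RHS]mxE.
Qed.
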